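(* Let $\eta\in\{231,132\}$. For every integer $n\ge 3$ and every $M\in\{0,\dots,n-1\}$, $$P_n^{\text{av}(\eta)}\big(W_{\mathcal{S}(n,M)}\big)=\frac{C_{n-1}}{C_n}=\frac{n+1}{2(2n-1)}.$$ In particular, for any choice of $M_n\in\{0,\dots,n-1\}$ ($n\ge3$), the probability $P_n^{\text{av}(\eta)}(W_{\mathcal{S}(n,M_n)})$ is decreasing in $n$ and $$\lim_{n\to\infty}P_n^{\text{av}(\eta)}\big(W_{\mathcal{S}(n,M_n)}\big)=\frac14.$$
   Context: $S_n$ is the set of permutations $\sigma=\sigma_1\cdots\sigma_n$ of $[n]=\{1,\dots,n\}$. In the secretary problem, $n$ items with ranks $1,\dots,n$ arrive one at a time, $\sigma_i$ being the rank of the $i$th item to arrive; $n$ is the highest rank. The observer sees only the relative ranks of the items that have arrived so far. For $M\in\{0,1,\dots,n-1\}$, the strategy $\mathcal{S}(n,M)$ is: reject the first $M$ items, then select the first later-arriving item whose rank is higher than that of each of the first $M$ items, if such an item exists (for $M=0$, this means the first item is selected). $W_{\mathcal{S}(n,M)}\subset S_n$ is the event that the observer using $\mathcal{S}(n,M)$ selects the item of rank $n$. Pattern avoidance: for $\eta=\eta_1\eta_2\eta_3\in S_3$ and $\sigma\in S_n$, $\sigma$ contains $\eta$ if there are indices $1\le i_1<i_2<i_3\le n$ such that for all $1\le j,k\le 3$, $\sigma_{i_j}<\sigma_{i_k}$ if and only if $\eta_j<\eta_k$; otherwise $\sigma$ avoids $\eta$. $S_n^{\text{av}(\eta)}$ is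 the set of $\sigma\in S_n$ avoiding $\eta$, and $P_n^{\text{av}(\eta)}$ is the uniform probability measure on $S_n^{\text{av}(\eta)}$. $C_n=\frac{1}{n+1}\binom{2n}{n}$ for $n\ge1$ and $C_0=1$ (Catalan numbers). *)

(* Defs.v *)
From mathcomp Require Import all_boot all_order all_algebra all_fingroup.

Set Implicit Arguments.
Unset Strict Implicit.
Unset Printing Implicit Defensive.
Import Order.TTheory GRing.Theory Num.Theory.

(* Positions and values of s : 'S_n are 0-based: the item arriving at time
   i.+1 has rank (s i).+1, so the highest rank n is the value n.-1, and the
   first M items are those at the positions i with i < M. *)

Definition one_line (n : nat) (s : 'S_n) : seq nat :=
  [seq (s i).+1 | i <- enum 'I_n].

Definition contains (k n : nat) (eta : 'S_k) (s : 'S_n) : bool :=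
  [exists i : {ffun 'I_k -> 'I_n},
     [forall a : 'I_k, forall b : 'I_k, (a < b) ==> (i a < i b)] &&
     [forall a : 'I_k, forall b : 'I_k,
        (s (i a) < s (i b)) == (eta a < eta b)]].

Definition avoiders (k : nat) (eta : 'S_k) (n : nat) : {set 'S_n} :=
  [set s : 'S_n | ~~ contains eta s].

(* [enum 'I_n] is increasing, so [ohead] yields the earliest such arrival;
   [None] means that no item is selected. *)
Definition selected (n M : nat) (s : 'S_n) : option 'I_n :=
  ohead [seq i : 'I_n <- enum 'I_n |
           (M <= i) && [forall j : 'I_n, (j < M) ==> (s j < s i)]].

Definition win (n M : nat) : {set 'S_n} :=
  [set s : 'S_n | if selected M s is Some i then (s i).+1 == n else false].

Local Open Scope ring_scope.

Definition unif_prob (R : numFieldType) (T : finType) (A E : {set T}) : R :=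
  #|E :&: A|%:R / #|A|%:R.

Definition Pav (R : numFieldType) (k : nat) (eta : 'S_k) (n : nat)
    (E : {set 'S_n}) : R :=
  unif_prob R (avoiders eta n) E.

Definition catalan (R : numFieldType) (n : nat) : R :=
  'C(2 * n, n)%N%:R / (n%:R + 1).

(* Main.v *)
Require Import Defs.
From mathcomp Require Import all_boot all_order all_algebra all_fingroup.
From mathcomp Require Import all_classical all_reals all_analysis.
From mathcomp Require Import ring lra zify.
Import Order.TTheory GRing.Theory Num.Theory.
Import numFieldNormedType.Exports.

(** A permutation avoiding 231 or 132 splits at its maximum as [l ++ m :: r]:
    for 231 every entry of [l] is below every entry of [r], for 132 above, and
    [l], [r] are arbitrary avoiders up to a shift of their values
    ([av_words_decomp]).  Hence, for both patterns, the numbers [c n] of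
    avoiders satisfy the Catalan recurrence, which is solved by
    [catalan_convolution].

    The threshold strategy with parameter [M] wins on [l ++ m :: r] exactly
    when [M <= size l] and no entry of [l] at a position [>= M] exceeds the
    first [M] entries ([select_word_split]); the latter says that [l] is empty
    or that its maximum lies among its first [M] entries
    ([record_free_split]).  So the number of winning avoiders of length
    [n.+1] is the sum, over the position [k >= M] of the maximum and the
    position [j < M] of the maximum of the prefix, of
    [c j * c (k - 1 - j) * c (n - k)], with the term [c n] for [k = 0] when
    [M = 0].

    This sum does not depend on [M] ([convolution_threshold]): going from [M]
    to [M.+1] loses the terms with [k = M], in total [c M * c (n - M)] by the
    recurrence on the index [j], and gains the terms with [j = M], again
    [c M * c (n - M)] by the recurrence on the index [k].  At [M = 0] only
    [c 0 * c n] remains, so exactly [c n] of the [c n.+1] avoiders win.  The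
    remaining claims follow from
    [(n + 1) / (2 (2 n - 1)) = 1 / 4 + 3 / (4 (2 n - 1))]. *)

Local Open Scope classical_set_scope.
Local Open Scope nat_scope.

(** * Pattern avoidance for words, and splitting at the maximum *)

(** The order forced between an entry to the left and an entry to the right of
    a larger one: increasing when 231 is avoided ([up = true]), decreasing when
    132 is. *)
Definition lt_dir (up : bool) : rel nat := if up then ltn else gtn.

(** Avoidance of 231 or 132 as a recursion on the first entry [x] of the pattern
    occurrence, so that concatenation is handled by [pairwise_cat]; see
    [peak_freeP] for the usual form. *)
Fixpoint peak_free (up : bool) (w : seq nat) : bool :=
  if w is x :: s then
    pairwise (fun b c => (x < b) && (c < b) ==> lt_dir up x c) s
    && peak_free up s
  else true.

(** An occurrence that is not inside [l] or [r] starts in [l] and ends in [r],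
    as [m] is too large to be an outer entry; so it violates the order between
    [l] and [r].  Conversely two entries out of order form one with [m]. *)
Lemma peak_free_split (up : bool) (l r : seq nat) (m : nat) :
  all (ltn^~ m) l -> all (ltn^~ m) r ->
  peak_free up (l ++ m :: r) =
    [&& peak_free up l, peak_free up r & allrel (lt_dir up) l r].
Proof.
move=> lm rm; elim: l lm => [_|x l IH /= /andP[xm lm]] /=.
  rewrite andbT; case: (peak_free _ _); rewrite ?andbF ?andbT //.
  elim: r rm => //= y r IHr /andP[ym rm]; rewrite IHr // andbT.
  by apply/allP=> c rc; rewrite [m < y]ltnNge (ltnW ym).
rewrite {}IH // pairwise_cat /= allrel_consl.
set q := (q in pairwise q l).
have -> : all (q m) r = all (lt_dir up x) r.
  by apply: eq_in_all => c /(allP rm) /= cm; rewrite /q xm cm.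
have qr b : all (lt_dir up x) r -> all (q b) r.
  by move/allP=> xr; apply/allP=> c rc; rewrite /q xr // implybT.
case xr: (all (lt_dir up x) r); last by rewrite ?(andbF, andFb).
have -> : allrel q l (m :: r).
  apply/allP=> b lb; rewrite /= qr // andbT /q.
  by rewrite [m < b]ltnNge (ltnW (allP lm b lb)) andbF.
have -> : pairwise q r.
  move: (qr) xr; elim: (r) => //= y s IHs _ /andP[xy xs].
  by apply/andP; split; [apply/allP=> c /(allP xs) xc; rewrite /q xc implybT
    | apply: IHs => // b /allP h; apply/allP=> c sc; rewrite /q h // implybT].
by rewrite /= !andbT -andbA.
Qed.

Lemma peak_free_shift (up : bool) (k : nat) (w : seq nat) :
  peak_free up (map (addn k) w) = peak_free up w.
Proof.
elim: w => //= x s ->; congr (_ && _); rewrite pairwise_map.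
apply: eq_pairwise => b c /=; rewrite !ltn_add2l.
by case: up; rewrite /lt_dir /= ltn_add2l.
Qed.

Lemma peak_freeP (up : bool) (w : seq nat) :
  reflect (forall i j k, i < j -> j < k -> k < size w ->
             nth 0 w i < nth 0 w j -> nth 0 w k < nth 0 w j ->
             lt_dir up (nth 0 w i) (nth 0 w k))
          (peak_free up w).
Proof.
elim: w => [|x s IH] /=; first by left.
apply: (iffP andP) => [[/(pairwiseP 0) xs /IH fs]|fw].
- move=> [|i] [|j] [|k] //= ij jk ks; last exact: fs.
  move=> xj kj; have := xs j k; rewrite !inE xj kj /=; apply=> //.
  exact: ltn_trans jk ks.
- split; last by apply/IH=> i j k ij jk ks; apply: (fw i.+1 j.+1 k.+1).
  apply/(pairwiseP 0) => j k; rewrite !inE => _ ks jk; apply/implyP=> /andP[].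
  exact: (fw 0 j.+1 k.+1).
Qed.

(** The avoider whose maximum separates the patterns of [l] and [r]: the side
    that has to carry the larger values is shifted up. *)
Definition glue (up : bool) (l r : seq nat) : seq nat :=
  map (addn (if up then 0 else size r)) l
  ++ (size l + size r) :: map (addn (if up then size l else 0)) r.

Definition av_words (up : bool) (n : nat) : seq (seq nat) :=
  [seq w <- permutations (iota 0 n) | peak_free up w].

Lemma mem_av_words up n w :
  (w \in av_words up n) = peak_free up w && perm_eq w (iota 0 n).
Proof. by rewrite mem_filter mem_permutations. Qed.

Lemma size_av_word up n w : w \in av_words up n -> size w = n.
Proof. by rewrite mem_av_words => /andP[_ /perm_size]; rewrite size_iota. Qed.

Lemma av_word_lt up n w : w \in av_words up n -> all (ltn^~ n) w.
Proof.
rewrite mem_av_words => /andP[_ /perm_mem wn].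
by apply/allP=> x; rewrite wn mem_iota.
Qed.

Lemma shift_lt (a k n : nat) (s : seq nat) :
  all (ltn^~ k) s -> a + k <= n -> all (ltn^~ n) (map (addn a) s).
Proof.
move=> /allP sk akn; apply/allP=> _ /mapP[x /sk /= xk ->].
by apply: leq_trans akn; rewrite ltn_add2l.
Qed.

(** If all of [a] is below all of [b], sorting both sides gives the sorted word,
    so [a] and [b] occupy an initial and a final interval of values. *)
Lemma split_iota (n : nat) (a b : seq nat) :
  perm_eq (a ++ b) (iota 0 n) -> allrel ltn a b ->
  perm_eq a (iota 0 (size a)) /\ perm_eq b (iota (size a) (size b)).
Proof.
move=> abn ab.
have sab : sort leq a ++ sort leq b = iota 0 (size a) ++ iota (size a) (size b).
  rewrite -iotaD -size_cat (perm_size abn) size_iota.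
  apply: (sorted_eq leq_trans anti_leq).
  - rewrite (sorted_pairwise leq_trans) pairwise_cat.
    rewrite -!(sorted_pairwise leq_trans) !sort_sorted ?andbT;
      try exact: leq_total.
    apply/allrelP=> x y; rewrite !mem_sort => ax yb.
    exact/ltnW/(allrelP ab).
  - exact: iota_sorted.
  - by apply: perm_trans abn; apply: perm_cat; rewrite perm_sort.
move/eqP: sab; rewrite eqseq_cat ?size_sort ?size_iota //.
by case/andP=> /eqP <- /eqP <-; rewrite !(perm_sym _ (sort _ _)) !perm_sort.
Qed.

Lemma perm_iota_unshift (a k : nat) (s : seq nat) :
  perm_eq s (iota a k) ->
  exists2 t, s = map (addn a) t & perm_eq t (iota 0 k).
Proof.
move=> sak; exists (map (subn^~ a) s).
  rewrite -map_comp -[LHS]map_id; apply/eq_in_map=> x /=.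
  by rewrite (perm_mem sak) mem_iota => /andP[ax _]; rewrite subnKC.
have -> : iota 0 k = map (subn^~ a) (iota a k); last exact: perm_map.
have -> : iota a k = map (addn a) (iota 0 k) by rewrite -iotaDl addn0.
rewrite -map_comp -[LHS]map_id.
by apply: eq_map => x /=; rewrite addKn.
Qed.

Lemma perm_max_iota (n : nat) (a b : seq nat) :
  perm_eq (a ++ n :: b) (iota 0 n.+1) = perm_eq (a ++ b) (iota 0 n).
Proof.
rewrite -[n.+1]addn1 iotaD add0n (perm_catCA a [:: n]).
by rewrite (permPr (permEl (perm_catC _ _))) perm_cons.
Qed.

Lemma glue_av_word (up : bool) (k n : nat) (l r : seq nat) :
  k <= n -> l \in av_words up k -> r \in av_words up (n - k) ->
  glue up l r \in av_words up n.+1.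
Proof.
move=> kn lk rk; have := lk; have := rk; rewrite !mem_av_words.
case/andP=> fr pr /andP[fl pl].
have := size_av_word _ _ _ lk; have := size_av_word _ _ _ rk => sr sl.
rewrite /glue sr sl subnKC //.
have ltl := av_word_lt _ _ _ lk; have ltr := av_word_lt _ _ _ rk.
rewrite peak_free_split; last 2 first.
- by apply: shift_lt ltl _; case: up {lk rk fr fl}; rewrite ?subnK.
- by apply: shift_lt ltr _; case: up {lk rk fr fl}; rewrite ?subnKC ?leq_subr.
rewrite !peak_free_shift fl fr /=; apply/andP; split.
  apply/allrelP=> u v /mapP[x /(allP ltl) /= xk ->].
  move=> /mapP[y /(allP ltr) /= yk ->].
  case: up {lk rk fr fl}; rewrite /lt_dir /= !add0n.
    exact: ltn_addr.
  exact: ltn_addr.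
rewrite perm_max_iota.
case: up {lk rk fr fl} => /=.
  rewrite -[n in iota 0 n](subnKC kn) iotaD; apply: perm_cat.
    by rewrite (eq_map add0n) map_id.
  by rewrite -[iota _ _]/(iota (0 + k) _) addnC iotaDl perm_map.
rewrite perm_catC -[n in iota 0 n](subnK kn) iotaD; apply: perm_cat.
  by rewrite (eq_map add0n) map_id.
by rewrite -[iota _ _]/(iota (0 + (n - k)) _) addnC iotaDl perm_map.
Qed.

Lemma av_word_unglue (up : bool) (n : nat) (w : seq nat) :
  w \in av_words up n.+1 ->
  exists l r, [/\ l \in av_words up (size l), r \in av_words up (n - size l),
                  size l <= n & w = glue up l r].
Proof.
rewrite mem_av_words => /andP[fw pw].
have nw : n \in w by rewrite (perm_mem pw) mem_iota /= ltnS leqnn.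
case/splitPr: nw fw pw => a b fab.
rewrite perm_max_iota => pab.
have sab : size a + size b = n by rewrite -size_cat (perm_size pab) size_iota.
have abn x : x \in a ++ b -> x < n by rewrite (perm_mem pab) mem_iota.
rewrite peak_free_split in fab; last 2 first.
- by apply/allP=> x xa; apply: abn; rewrite mem_cat xa.
- by apply/allP=> x xa; apply: abn; rewrite mem_cat xa orbT.
case/and3P: fab => fa fb ab.
have an : size a <= n by rewrite -sab leq_addr.
have nab : n - size a = size b by rewrite -sab addKn.
case: up fa fb ab => fa fb ab.
  have [pa pb] := split_iota _ _ _ pab ab.
  have [t tb pt] := perm_iota_unshift _ _ _ pb.
  have st : size t = size b by rewrite tb size_map.
  exists a, t; rewrite !mem_av_words nab fa pa pt an.
  rewrite -(peak_free_shift _ (size a)) -tb fb; split=> //.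
  by rewrite /glue st sab -tb (eq_map add0n) map_id.
rewrite perm_catC in pab.
have [|pb pa] := split_iota _ _ _ pab.
  by apply/allrelP=> x y xb ya; apply: (allrelP ab).
have [t ta pt] := perm_iota_unshift _ _ _ pa.
have st : size t = size a by rewrite ta size_map.
exists t, b; rewrite !mem_av_words st nab fb pb pt an.
rewrite -(peak_free_shift _ (size b) t) -ta fa; split=> //.
by rewrite /glue st sab -ta (eq_map add0n) map_id.
Qed.

Definition av_pairs (up : bool) (n k : nat) : seq (seq nat * seq nat) :=
  [seq (l, r) | l <- av_words up k, r <- av_words up (n - k)].

Lemma uniq_av_words up n : uniq (av_words up n).
Proof. by rewrite filter_uniq // permutations_uniq. Qed.

(** The position of the maximum recovers the sizes of the two parts. *)
Lemma glue_inj (up : bool) (n k k' : nat) (l r l' r' : seq nat) :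
  k <= n -> k' <= n ->
  l \in av_words up k -> r \in av_words up (n - k) ->
  l' \in av_words up k' -> r' \in av_words up (n - k') ->
  glue up l r = glue up l' r' -> [/\ k = k', l = l' & r = r'].
Proof.
have idx j s t : j <= n -> s \in av_words up j -> t \in av_words up (n - j) ->
    index n (glue up s t) = j.
  move=> jn sj tj; have sz := size_av_word _ _ _ sj.
  have szt := size_av_word _ _ _ tj.
  rewrite /glue sz szt subnKC // index_cat size_map sz /= eqxx addn0.
  case: ifP => // /mapP[x /(allP (av_word_lt _ _ _ sj)) /= xj nE].
  suff : n < n by rewrite ltnn.
  rewrite {1}nE; case: (up); rewrite ?add0n; first exact: leq_trans xj jn.
  by rewrite -[n in _ < n](subnK jn) ltn_add2l.
move=> kn kn' lk rk lk' rk' E.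
have kk' : k = k' by rewrite -(idx k l r kn lk rk) E (idx k' l' r').
rewrite -{}kk' in lk' rk' *; move: E; rewrite /glue.
rewrite !(size_av_word _ _ _ lk, size_av_word _ _ _ lk',
          size_av_word _ _ _ rk, size_av_word _ _ _ rk').
move/eqP; rewrite eqseq_cat ?size_map; last first.
  by rewrite (size_av_word _ _ _ lk) (size_av_word _ _ _ lk').
case/andP=> /eqP/(inj_map (@addnI _)) -> /eqP[/(inj_map (@addnI _)) ->].
by split.
Qed.

Lemma av_words_decomp (up : bool) (n : nat) :
  perm_eq (av_words up n.+1)
    [seq glue up p.1 p.2 | k <- iota 0 n.+1, p <- av_pairs up n k].
Proof.
apply: uniq_perm; first exact: uniq_av_words.
  apply: allpairs_uniq_dep; first exact: iota_uniq.
    move=> k _; apply: allpairs_uniq; try exact: uniq_av_words.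
    by move=> [? ?] [? ?] _ _ [-> ->].
  move=> x y /allpairsPdep[k [p [kn kp ->]]].
  move=> /allpairsPdep[k' [p' [kn' kp' ->]]].
  case/allpairsP: kp => [[l r] /= [lk rk ->]].
  case/allpairsP: kp' => [[l' r'] /= [lk' rk' ->]].
  rewrite !mem_iota /= !ltnS in kn kn' => E.
  by have [<- <- <-] := glue_inj _ _ _ _ _ _ _ _ kn kn' lk rk lk' rk' E.
move=> w; apply/idP/allpairsPdep.
  case/av_word_unglue=> l [r [ll rl ln ->]].
  exists (size l), (l, r); split; rewrite ?mem_iota //.
  by apply/allpairsP; exists (l, r).
case=> k [p []]; rewrite mem_iota /= ltnS => kn.
case/allpairsP=> [[l r] /= [lk rk ->]] ->.
exact: glue_av_word kn lk rk.
Qed.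

(** Counting principle behind all the convolutions: a property of avoiders that
    depends only on the part before the maximum. *)
Lemma count_av_words_glue (up : bool) (n : nat) (P : pred (seq nat))
    (q : nat -> pred (seq nat)) :
  (forall k l r, k <= n -> l \in av_words up k -> r \in av_words up (n - k) ->
     P (glue up l r) = q k l) ->
  count P (av_words up n.+1) =
    \sum_(k < n.+1) count (q k) (av_words up k) * size (av_words up (n - k)).
Proof.
move=> Pq; rewrite (seq.permP (av_words_decomp up n)).
rewrite count_flatten -map_comp sumnE big_map.
rewrite -[iota 0 n.+1]/(index_iota 0 n.+1) big_mkord.
apply: eq_bigr => k _ /=; rewrite count_map /av_pairs.
have : forall l r, l \in av_words up k -> r \in av_words up (n - k) ->
    P (glue up l r) = q k l by move=> *; apply: Pq; rewrite // -ltnS.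
elim: (av_words up k) => //= l s IH Ps.
rewrite count_cat IH; last by move=> l' r' ls; apply: Ps; rewrite inE ls orbT.
rewrite mulnDl count_map; congr addn.
have {Ps} : forall r, r \in av_words up (n - k) -> P (glue up l r) = q k l.
  by move=> r; apply: Ps; rewrite inE eqxx.
elim: (av_words up (n - k)) => [|r t IHt] Pr /=; first by rewrite muln0.
rewrite mulnS IHt => [|r' rt]; last by apply: Pr; rewrite inE rt orbT.
by rewrite Pr ?inE ?eqxx.
Qed.

(** * The threshold strategy on words *)

(** The strategy returns the value it selects, which is what survives when a
    permutation is replaced by the word of its values. *)
Definition select_word (M : nat) (w : seq nat) : option nat :=
  ohead [seq x <- drop M w | all (ltn^~ x) (take M w)].

(** The strategy never stops on [w]. *)
Definition record_free (M : nat) (w : seq nat) : bool :=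
  ~~ has (fun x => all (ltn^~ x) (take M w)) (drop M w).

Lemma record_free_shift (M k : nat) (w : seq nat) :
  record_free M (map (addn k) w) = record_free M w.
Proof.
rewrite /record_free -map_take -map_drop has_map; congr (~~ _).
apply: eq_has => x /=; rewrite all_map; apply: eq_all => y /=.
by rewrite ltn_add2l.
Qed.

(** If the maximum is among the first [M] entries nothing beats them;
    otherwise the maximum itself does. *)
Lemma record_free_split (M m : nat) (l r : seq nat) :
  all (ltn^~ m) l -> all (ltn^~ m) r ->
  record_free M (l ++ m :: r) = (size l < M).
Proof.
move=> lm rm; rewrite /record_free take_cat drop_cat.
have [lM|Ml|->] := ltngtP (size l) M.
- rewrite -[M - size l]prednK ?subn_gt0 //=.
  apply/hasP=> -[x /mem_drop /(allP rm) /= xm].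
  by rewrite all_cat /= [m < x]ltnNge (ltnW xm) !andbF.
- rewrite has_cat /=; apply/negbTE; rewrite negbK.
  rewrite (_ : all _ (take M l)) ?orbT //.
  by apply/allP=> x /mem_take /(allP lm).
- by rewrite subnn take0 drop0 cats0 /= lm.
Qed.

(** Since [m] beats everything, the strategy stops at [m] unless [m] is rejected
    among the first [M] items or a selection was made inside [l]. *)
Lemma select_word_split (M m : nat) (l r : seq nat) :
  all (ltn^~ m) l -> all (ltn^~ m) r ->
  (select_word M (l ++ m :: r) == Some m) = (M <= size l) && record_free M l.
Proof.
move=> lm rm; rewrite /select_word; case: leqP => [Ml|lM] /=.
- have -> : drop M (l ++ m :: r) = drop M l ++ m :: r.
    rewrite drop_cat; case: ltngtP Ml => // -> _.
    by rewrite subnn drop_size.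
  rewrite takel_cat // filter_cat /record_free.
  rewrite has_filter negbK; set f := seq.filter _ _.
  case E: f => [|x s] /=.
    rewrite (_ : all _ _) /= ?eqxx //.
    by apply/allP=> x /mem_take /(allP lm).
  have : x \in f by rewrite E inE eqxx.
  rewrite mem_filter => /andP[_ /mem_drop /(allP lm) /= xm].
  by apply/eqP=> -[xE]; rewrite xE ltnn in xm.
- rewrite take_cat drop_cat ltnNge (ltnW lM) /=.
  rewrite -[M - size l]prednK ?subn_gt0 //= (_ : seq.filter _ _ = [::]) //.
  apply/eqP; rewrite -(negbK (_ == _)) -has_filter; apply/hasP=> -[x].
  move=> /mem_drop /(allP rm) /= xm.
  by rewrite all_cat /= [m < x]ltnNge (ltnW xm) !andbF.
Qed.

(** * Counting the winning avoiders *)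

Lemma size_av_wordsS up n :
  size (av_words up n.+1) =
    \sum_(k < n.+1) size (av_words up k) * size (av_words up (n - k)).
Proof.
by rewrite -count_predT (count_av_words_glue _ _ _ (fun=> predT)).
Qed.

Lemma count_record_free up n M :
  count (record_free M) (av_words up n.+1) =
    \sum_(k < n.+1 | k < M)
      size (av_words up k) * size (av_words up (n - k)).
Proof.
rewrite (count_av_words_glue _ _ _ (fun k _ => k < M)) => [|k l r kn lk rk].
  rewrite [RHS]big_mkcond; apply: eq_bigr => k _; case: ifP => _.
    by rewrite count_predT.
  by rewrite count_pred0.
have [sl sr] := (size_av_word _ _ _ lk, size_av_word _ _ _ rk).
rewrite /glue record_free_split ?size_map ?sl //.
  apply: shift_lt (av_word_lt _ _ _ lk) _.
  by rewrite sr; case: (up); rewrite ?add0n ?leq_addr // addnC.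
apply: shift_lt (av_word_lt _ _ _ rk) _.
by rewrite sr; case: (up); rewrite ?add0n ?leq_addl.
Qed.

Lemma count_winning up n M :
  count (fun w => select_word M w == Some n) (av_words up n.+1) =
    \sum_(k < n.+1 | M <= k)
      count (record_free M) (av_words up k) * size (av_words up (n - k)).
Proof.
rewrite (count_av_words_glue _ _ _ (fun k l => (M <= k) && record_free M l)).
  rewrite [RHS]big_mkcond; apply: eq_bigr => k _; case: ifP => _ //.
  by rewrite count_pred0.
move=> k l r kn lk rk.
have [sl sr] := (size_av_word _ _ _ lk, size_av_word _ _ _ rk).
rewrite /glue sl sr subnKC // select_word_split ?size_map ?sl //.
- by rewrite record_free_shift.
- apply: shift_lt (av_word_lt _ _ _ lk) _.
  by case: (up); rewrite ?add0n // subnK.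
- apply: shift_lt (av_word_lt _ _ _ rk) _.
  by case: (up); rewrite ?add0n ?leq_subr // subnKC.
Qed.

(** By induction on [M].  Here [c] is the number of avoiders and [B M k] the
    number of those of length [k] that are record-free from position [M]. *)
Lemma convolution_threshold (c : nat -> nat) (B : nat -> nat -> nat) :
  c 0 = 1 ->
  (forall n, c n.+1 = \sum_(k < n.+1) c k * c (n - k)) ->
  (forall M, B M 0 = 1) ->
  (forall M n, B M n.+1 = \sum_(k < n.+1 | k < M) c k * c (n - k)) ->
  forall n M, M <= n ->
    \sum_(k < n.+1 | M <= k) B M k * c (n - k) = c n.
Proof.
move=> c0 cS B0 BS n M.
(* The bound [j < M] is vacuous on the diagonal: the full recurrence applies. *)
have BE M' : B M' M' = c M'.
  case: M' => [|m]; rewrite ?B0 ?BS ?cS //.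
  by apply: eq_bigl => k; rewrite ltn_ord.
have BM k M' : M' < k -> B M'.+1 k = B M' k + c M' * c (k - M'.+1).
  case: k => // k; rewrite ltnS => Mk; rewrite !BS subSS.
  rewrite (bigD1 (Ordinal (Mk : M' < k.+1))) //= addnC; congr addn.
  apply: eq_bigl => i; rewrite ltnS leq_eqVlt -val_eqE /=.
  by case: ltngtP.
have range M' : \sum_(k < n.+1 | M' <= k) B M' k * c (n - k)
    = \sum_(M' <= k < n.+1) B M' k * c (n - k).
  by rewrite big_geq_mkord.
elim: M => [|M IH] Mn.
  rewrite big_ord_recl B0 mul1n subn0 big1 ?addn0 // => k _.
  by rewrite BS big_pred0.
(* The term [k = M] of the sum for [M] must equal the [j = M] terms gained. *)
rewrite -{}IH 1?ltnW // !range [RHS]big_ltn ?ltnS 1?ltnW // BE addnC.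
rewrite big_nat (eq_bigr (fun k => B M k * c (n - k)
    + c M * c (k - M.+1) * c (n - k))); last first.
  by move=> k /andP[Mk _]; rewrite BM // mulnDl.
rewrite -big_nat big_split /=; congr addn.
rewrite -{1}[M.+1]add0n big_addn subSS -[n - M]prednK ?subn_gt0 // cS.
rewrite big_distrr big_mkord; apply: eq_bigr => i _.
by rewrite addnK -mulnA; congr (_ * (_ * c _)); lia.
Qed.

Lemma count_winning_words up n M : M <= n ->
  count (fun w => select_word M w == Some n) (av_words up n.+1) =
    size (av_words up n).
Proof.
move=> Mn; rewrite count_winning.
apply: (convolution_threshold (fun k => size (av_words up k))
  (fun M k => count (record_free M) (av_words up k))) => //.
- exact: size_av_wordsS.
- by move=> m k; rewrite count_record_free.
Qed.

(** * From permutations to words *)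

Definition word (n : nat) (s : 'S_n) : seq nat :=
  [seq val (s i) | i <- enum 'I_n].

Lemma nth_word (n : nat) (s : 'S_n) (i : 'I_n) : nth 0 (word n s) i = s i.
Proof. by rewrite (nth_map i) ?size_enum_ord // nth_ord_enum. Qed.

Lemma size_word (n : nat) (s : 'S_n) : size (word n s) = n.
Proof. by rewrite size_map size_enum_ord. Qed.

Lemma word_inj (n : nat) : injective (word n).
Proof.
by move=> s t st; apply/permP=> i; apply: val_inj; rewrite /= -!nth_word st.
Qed.

Lemma word_permutation (n : nat) (s : 'S_n) :
  word n s \in permutations (iota 0 n).
Proof.
rewrite mem_permutations -val_enum_ord /word map_comp perm_map //.
apply: uniq_perm; [|exact: enum_uniq|].
  by rewrite (map_inj_uniq perm_inj) enum_uniq.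
move=> i; rewrite mem_enum; apply/mapP; exists (s^-1%g i); rewrite ?mem_enum //.
by rewrite permKV.
Qed.

(** [word] hits every permutation of [iota 0 n]: it is injective into a list of
    the same length [n`!]. *)
Lemma card_words (n : nat) (E : {set 'S_n}) (p : pred (seq nat)) :
  (forall s, (s \in E) = p (word n s)) ->
  #|E| = count p (permutations (iota 0 n)).
Proof.
move=> Ep; have uw : uniq (map (word n) (enum 'S_n)).
  by rewrite map_inj_uniq ?enum_uniq //; apply: word_inj.
have sw : {subset map (word n) (enum 'S_n) <= permutations (iota 0 n)}.
  by move=> _ /mapP[s _ ->]; apply: word_permutation.
have [|_ mw] := uniq_min_size uw sw.
  rewrite size_permutations ?iota_uniq // size_iota size_map.
  by rewrite -cardT card_Sn.
rewrite -(seq.permP (uniq_perm uw (permutations_uniq _) mw)).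
rewrite count_map cardE -size_filter; congr size.
rewrite enumT {1}/enum_mem; apply: eq_filter => s /=; exact: Ep.
Qed.

Lemma one_line_nth (k : nat) (eta : 'S_k) (i : 'I_k) :
  (eta i).+1 = nth 0 (one_line eta) i.
Proof. by rewrite (nth_map i) ?size_enum_ord // nth_ord_enum. Qed.

Lemma avoids_word (up : bool) (eta : 'S_3) (n : nat) (s : 'S_n) :
  one_line eta = (if up then [:: 2; 3; 1] else [:: 1; 3; 2]) ->
  ~~ contains eta s = peak_free up (word n s).
Proof.
move=> eE.
pose e0 : 'I_3 := Ordinal (isT : 0 < 3).
pose e1 : 'I_3 := Ordinal (isT : 1 < 3).
pose e2 : 'I_3 := Ordinal (isT : 2 < 3).
have [h0 h1 h2] : [/\ eta e0 = (if up then 1 else 0) :> nat,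
    eta e1 = 2 :> nat & eta e2 = (if up then 0 else 1) :> nat].
  by split; apply: succn_inj; rewrite one_line_nth eE; case: (up).
apply/idP/idP=> [nc|/peak_freeP pf].
- apply/peak_freeP=> i j k ij jk; rewrite size_word => kn wij wkj.
  apply: contraR nc => nik; apply/existsP.
  pose i' : 'I_n := Ordinal (ltn_trans ij (ltn_trans jk kn)).
  pose j' : 'I_n := Ordinal (ltn_trans jk kn).
  pose k' : 'I_n := Ordinal kn.
  exists [ffun a : 'I_3 => nth i' [:: i'; j'; k'] a].
  move: wij wkj nik; rewrite -[i]/(val i') -[j]/(val j') -[k]/(val k').
  rewrite !nth_word => wij wkj nik.
  have sik : s i' != s k' :> nat.
    rewrite (inj_eq val_inj) (inj_eq perm_inj) -val_eqE /= neq_ltn.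
    by rewrite (ltn_trans ij jk).
  apply/andP; split.
    apply/forallP=> a; apply/forallP=> b; rewrite !ffunE.
    by case: a b => -[|[|[|//]]] ? [[|[|[|//]]]] ? //=;
      rewrite (ltn_trans ij jk).
  apply/forallP=> a; apply/forallP=> b; rewrite !ffunE.
  have ae (c : 'I_3) : [\/ c = e0, c = e1 | c = e2].
    by case: c => -[|[|[|//]]] p; [constructor 1|constructor 2|constructor 3];
      apply: val_inj.
  (* [wij], [wkj], [nik] and [sik] determine the relative order of all three
     values. *)
  case: (ae a) => ->; case: (ae b) => ->; rewrite ?(h0, h1, h2) /=;
    move: nik sik wij wkj; rewrite /lt_dir; case: (up) => /=; case: ltngtP; lia.
- apply/existsP=> -[f /andP[/forallP mon /forallP pat]].
  have m01 : f e0 < f e1 by have /forallP/(_ e1) := mon e0.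
  have m12 : f e1 < f e2 by have /forallP/(_ e2) := mon e1.
  have p a b : (s (f a) < s (f b)) = (eta a < eta b).
    by have /forallP/(_ b)/eqP := pat a.
  have := pf (f e0) (f e1) (f e2) m01 m12.
  rewrite size_word !nth_word !p h0 h1 h2 ltn_ord.
  have := p e0 e2; have := p e2 e0; rewrite h0 h2.
  rewrite /lt_dir; case: (up) => /= q20 q02 /(_ isT isT isT).
    by rewrite q02.
  by rewrite q20.
Qed.

Lemma selected_word (n M : nat) (s : 'S_n) :
  omap (fun i => val (s i)) (selected M s) = select_word M (word n s).
Proof.
rewrite /selected /select_word.
have -> (T : Type) (f : 'I_n -> T) (t : seq 'I_n) :
  omap f (ohead t) = ohead (map f t) by case: t.
congr ohead; rewrite /word -map_take -map_drop filter_map; congr map.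
rewrite -[in LHS](cat_take_drop M (enum 'I_n)) filter_cat.
have tM i : i \in take M (enum 'I_n) -> i < M.
  move=> it; have := map_f val it; rewrite map_take val_enum_ord take_iota.
  by rewrite mem_iota /= => h; apply: leq_trans h (geq_minl _ _).
have dM i : i \in drop M (enum 'I_n) -> M <= i.
  move=> it; have := map_f val it; rewrite map_drop val_enum_ord drop_iota.
  by rewrite mem_iota => /andP[].
have tM' (i : 'I_n) : i < M -> i \in take M (enum 'I_n).
  move=> iM; have : i \in enum 'I_n by rewrite mem_enum.
  rewrite -[in X in X -> _](cat_take_drop M (enum _)) mem_cat.
  by case/orP=> // /dM; rewrite leqNgt iM.
rewrite (_ : seq.filter _ (take _ _) = [::]) /=; last first.
  apply/eqP; rewrite -(negbK (_ == _)) -has_filter; apply/hasP=> -[i /tM iM].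
  by rewrite leqNgt iM.
apply: eq_in_filter => i /dM -> /=; rewrite all_map.
apply/forallP/allP=> [h j /tM jM|h j] /=; first exact: (implyP (h j)).
by apply/implyP=> /tM' /h.
Qed.

Lemma win_word (n M : nat) (s : 'S_n.+1) :
  (s \in win n.+1 M) = (select_word M (word n.+1 s) == Some n).
Proof.
by rewrite inE -selected_word; case: selected => [i|].
Qed.

Lemma card_avoiders (up : bool) (eta : 'S_3) (n : nat) :
  one_line eta = (if up then [:: 2; 3; 1] else [:: 1; 3; 2]) ->
  #|avoiders eta n| = size (av_words up n).
Proof.
move=> eE; rewrite size_filter; apply: card_words => s.
by rewrite inE (avoids_word up).
Qed.

Lemma card_win_avoiders (up : bool) (eta : 'S_3) (n M : nat) :
  one_line eta = (if up then [:: 2; 3; 1] else [:: 1; 3; 2]) -> M <= n ->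
  #|win n.+1 M :&: avoiders eta n.+1| = size (av_words up n).
Proof.
move=> eE Mn; rewrite -(count_winning_words _ _ _ Mn) count_filter.
by apply: card_words => s; rewrite inE win_word inE (avoids_word up).
Qed.

(** * Catalan numbers in closed form *)

Local Open Scope ring_scope.

Lemma central_binomialS (F : numFieldType) (n : nat) :
  ('C(2 * n.+1, n.+1))%:R * (n%:R + 1) =
  2 * (2 * n%:R + 1) * ('C(2 * n, n))%:R :> F.
Proof.
have h1 := mul_bin_diag (2 * n.+1)%N n.
have h2 := mul_bin_down (2 * n).+1 n.
rewrite mulnS /= in h1; rewrite /= in h2.
have {}h2 : (2 * n).+1%:R * 'C(2 * n, n)%:R
    = n.+1%:R * 'C((2 * n).+1, n)%:R :> F.
  by rewrite -!natrM h2; congr (_ * _)%:R; lia.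
have {h1} : (2 * n).+2%:R * 'C((2 * n).+1, n)%:R
    = n.+1%:R * 'C(2 * n.+1, n.+1)%:R :> F.
  by rewrite -!natrM h1 mulnS.
have n0 : n.+1%:R != 0 :> F by rewrite pnatr_eq0.
have e1 : (2 * n).+1%:R = 2 * n%:R + 1 :> F by rewrite -natr1 natrM.
have e2 : (2 * n).+2%:R = 2 * (n%:R + 1) :> F.
  by rewrite -natr1 e1; ring.
have nE : n.+1%:R = n%:R + 1 :> F by rewrite natr1.
rewrite e1 nE in h2; rewrite e2 nE => h1; rewrite nE in n0.
apply: (mulfI n0).
transitivity ((n%:R + 1) * ((n%:R + 1) * 'C(2 * n.+1, n.+1)%:R) : F).
  by ring.
rewrite -h1.
transitivity (2 * (n%:R + 1) * ((n%:R + 1) * 'C((2 * n).+1, n)%:R) : F).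
  by ring.
by rewrite -h2; ring.
Qed.

(** The convolution telescopes: Gosper's algorithm gives the antidifference [G]
    below of the product of the two Catalan numbers. *)
Lemma catalan_convolution (F : numFieldType) (n : nat) :
  \sum_(k < n.+1) catalan F k * catalan F (n - k) = catalan F n.+1.
Proof.
pose b k : F := 'C(2 * k, k)%:R.
pose G j := b j * b (n.+1 - j)%N * (2 * j%:R - (n%:R + 1))
  / (2 * (n%:R + 1) * (n%:R + 2)).
have pos k : k%:R + 1 != 0 :> F by rewrite natr1 pnatr_eq0.
have n2 : n%:R + 2 != 0 :> F by rewrite -natrD pnatr_eq0 addn2.
have step (k : nat) : (k < n.+1)%N ->
    catalan F k * catalan F (n - k) = G k.+1 - G k.
  rewrite ltnS => kn; rewrite /G /catalan -!/(b _) subSS subSn //.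
  have bk : b k.+1 = 2 * (2 * k%:R + 1) * b k / (k%:R + 1).
    by rewrite -central_binomialS mulfK.
  have bm : b (n - k).+1 = 2 * (2 * (n - k)%:R + 1) * b (n - k)%N
      / ((n - k)%:R + 1).
    by rewrite -central_binomialS mulfK.
  rewrite bk bm; move: (pos k) (pos (n - k)%N) (pos n) n2.
  rewrite natrB // -natr1; move: (b k) (b (n - k)%N) => x y p1 p2 p3 p4.
  by field; rewrite p1 p2 p3 p4.
rewrite (eq_bigr (fun k : 'I_n.+1 => G k.+1 - G k)) => [|k _]; last exact: step.
rewrite -(big_mkord predT (fun k => G k.+1 - G k)) telescope_sumr //.
rewrite /G subn0 subnn /catalan -!/(b _) -natr1.
have -> : b 0 = 1 by [].
move: (pos n) n2 => p3 n2; rewrite mulr0; field.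
by rewrite p3 andbT (_ : 1 + n%:R + 1 = n%:R + 2) //; ring.
Qed.

Lemma size_av_words_catalan (F : numFieldType) (up : bool) (n : nat) :
  (size (av_words up n))%:R = catalan F n.
Proof.
elim/ltn_ind: n => -[|n] IH.
  by rewrite /catalan muln0 bin0 add0r divr1.
rewrite size_av_wordsS natr_sum -catalan_convolution; apply: eq_bigr => k _.
by rewrite natrM !IH // ltnS leq_subr.
Qed.

(** * Winning probabilities *)

Lemma catalan_ratio (F : numFieldType) (n : nat) : (0 < n)%N ->
  catalan F n.-1 / catalan F n = (n%:R + 1) / (2 * (2 * n%:R - 1)).
Proof.
case: n => // n _; rewrite /catalan /=.
have cS := central_binomialS F n.
have c0 : 'C(2 * n, n)%:R != 0 :> F by rewrite pnatr_eq0 -lt0n bin_gt0; lia.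
have n1 : n%:R + 1 != 0 :> F by rewrite natr1 pnatr_eq0.
have n2 : n%:R + 1 + 1 != 0 :> F by rewrite !natr1 pnatr_eq0.
have n3 : 2 * n%:R + 1 != 0 :> F by rewrite -natrM natr1 pnatr_eq0.
have -> : 'C(2 * n.+1, n.+1)%:R
    = 2 * (2 * n%:R + 1) * 'C(2 * n, n)%:R / (n%:R + 1) :> F.
  by rewrite -cS mulfK.
rewrite -[in n.+1%:R]natr1.
field; rewrite n1 n2 c0 !andbT.
by rewrite (_ : 2 * (n%:R + 1) - 1 = 2 * n%:R + 1) //; ring.
Qed.

Lemma Pav_win (F : numFieldType) (up : bool) (eta : 'S_3) (n M : nat) :
  one_line eta = (if up then [:: 2; 3; 1]%N else [:: 1; 3; 2]%N) -> (M < n)%N ->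
  Pav F eta (win n M) = catalan F n.-1 / catalan F n.
Proof.
case: n => // n eE Mn.
by rewrite /Pav /unif_prob (card_win_avoiders up) // (card_avoiders up) //
  !size_av_words_catalan.
Qed.

Theorem theorem1 (R : realType) (eta : 'S_3)
    (heta : one_line eta = [:: 2; 3; 1]%N \/ one_line eta = [:: 1; 3; 2]%N) :
  (forall n M : nat, (3 <= n)%N -> (M < n)%N ->
     Pav R eta (win n M) = catalan R n.-1 / catalan R n /\
     catalan R n.-1 / catalan R n = (n%:R + 1) / (2 * (2 * n%:R - 1))) /\
  (forall M : nat -> nat, (forall n : nat, (3 <= n)%N -> (M n < n)%N) ->
     (forall m n : nat, (3 <= m)%N -> (m < n)%N ->
        Pav R eta (win n (M n)) < Pav R eta (win m (M m))) /\
     (fun n : nat => Pav R eta (win n (M n))) @ \oo --> (1 / 4 : R)).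
Proof.
have Pn n M : (3 <= n)%N -> (M < n)%N ->
    Pav R eta (win n M) = catalan R n.-1 / catalan R n.
  by move=> _; case: heta => eE;
    [apply: (Pav_win _ true) | apply: (Pav_win _ false)].
have PE n M : (3 <= n)%N -> (M < n)%N ->
    Pav R eta (win n M) = 1 / 4 + 3 / (4 * (2 * n%:R - 1)).
  move=> n3 Mn; rewrite Pn // catalan_ratio; last exact: ltn_trans n3.
  have : (3 <= n%:R :> R) by rewrite ler_nat.
  by move=> h; field; apply/eqP; lra.
split=> [n M n3 Mn|M HM].
  by split; [exact: Pn | apply: catalan_ratio; exact: ltn_trans n3].
split=> [m n m3 mn|].
  have n3 := leq_trans m3 (ltnW mn).
  rewrite !PE ?HM // ltrD2l ltr_pM2l // ltf_pV2 ?posrE.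
  - by rewrite ltr_pM2l // ltrD2r ltr_pM2l // ltr_nat.
  - have : (3 <= n%:R :> R) by rewrite ler_nat.
    by lra.
  - have : (3 <= m%:R :> R) by rewrite ler_nat.
    by lra.
(* [3 / (4 (2 n - 1)) <= 1 / (n + 1)] as soon as [n >= 2]. *)
apply: (@squeeze_cvgr _ _ _ _ (fun=> 1 / 4) (fun n => 1 / 4 + harmonic n)).
- near=> n.
  have n3 : (3 <= n)%N by near: n; exists 3%N.
  have h : (3 <= n%:R :> R) by rewrite ler_nat.
  have p : 0 < 4 * (2 * n%:R - 1) :> R by lra.
  rewrite PE ?HM // lerDl lerD2l divr_ge0 ?(ltW p) //=.
  rewrite ler_pdivrMr // mulrC ler_pdivlMr ?ltr0Sn // -natr1; lra.
- exact: cvg_cst.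
- rewrite -[X in _ --> X]addr0; apply: cvgD; first exact: cvg_cst.
  exact: cvg_harmonic.
Unshelve. all: by end_near.
Qed.
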